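(* Let $n,d\in\mathbb N$, $\tau\in(0,n]$, $\sigma>0$, and let $v:\mathbb R^n\to\mathbb R^d$ be continuous. Suppose that for every $E\subset\mathbb R^n$ with $\mathcal H^\tau(E)=0$ and every $\varepsilon>0$ there exists a family of compact sets $\{D_i\}_{i\in\mathbb N}$ with $E\subset\bigcup_iD_i$, $\sum_i[\operatorname{diam}D_i]^\tau<\varepsilon$ and $\sum_i[\operatorname{diam}v(D_i)]^\sigma<\varepsilon$. Then $v$ has the $(\tau,\sigma)$-$N_*$-property: for every $q\in[0,\sigma]$ and every $E\subset\mathbb R^n$ with $\mathcal H^\tau(E)=0$, $$\mathcal H^{\tau(1-\frac q\sigma)}(E\cap v^{-1}(y))=0\quad\text{for }\mathcal H^q\text{-almost all }y\in\mathbb R^d.$$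
   Context: $\mathcal H^s$ denotes the $s$-dimensional Hausdorff measure; $\mathcal H^0$ is the counting measure. *)

(* Defs.v *)
From HB Require Import structures.
From mathcomp Require Import all_boot all_order all_algebra.
From mathcomp Require Import all_classical all_reals all_analysis.
Set Implicit Arguments. Unset Strict Implicit. Unset Printing Implicit Defensive.
Import Order.TTheory GRing.Theory Num.Theory.
Import numFieldNormedType.Exports.
Local Open Scope classical_set_scope.
Local Open Scope ring_scope.

Definition edist {R : realType} {m : nat} (x y : 'rV[R]_m) : R :=
  Num.sqrt (\sum_(i < m) (x ord0 i - y ord0 i) ^+ 2).

Definition ediam {R : realType} {m : nat} (A : set 'rV[R]_m) : \bar R :=
  ereal_sup [set (edist x y)%:E | x in A & y in A].

(* Contribution [diam A]^s of a covering set; empty sets contribute 0, and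
   0^0 = 1 (powR convention), so that H^0 is the counting measure. *)
Definition hterm {R : realType} {m : nat} (s : R) (A : set 'rV[R]_m) : \bar R :=
  if A == set0 then 0%E else ((fine (ediam A)) `^ s)%:E.

Definition hcontent {R : realType} {m : nat} (s delta : R) (E : set 'rV[R]_m) : \bar R :=
  ereal_inf [set (\sum_(0 <= i <oo) hterm s (C i))%E |
     C in [set C : nat -> set 'rV[R]_m |
            E `<=` \bigcup_i C i /\ forall i, (ediam (C i) <= delta%:E)%E]].

Definition hausdorff {R : realType} {m : nat} (s : R) (E : set 'rV[R]_m) : \bar R :=
  ereal_sup [set hcontent s delta E | delta in [set delta : R | 0 < delta]].

Definition N_star_property {R : realType} {n d : nat} (tau sigma : R)
  (v : 'rV[R]_n -> 'rV[R]_d) : Prop :=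
  forall q : R, 0 <= q <= sigma ->
  forall E : set 'rV[R]_n, hausdorff tau E = 0%E ->
  exists N : set 'rV[R]_d, hausdorff q N = 0%E /\
    forall y, ~ N y ->
      hausdorff (tau * (1 - q / sigma)) (E `&` v @^-1` [set y]) = 0%E.

(* Main.v *)
(* Write s = tau (1 - q / sigma), for 0 < q < sigma.  Take a cover D_i of E with
   sum diam(D_i)^tau and sum diam(v D_i)^sigma small.  A point y where
   H^s_oo(E cap v^-1(y)) exceeds t satisfies sum_i diam(D_i)^s 1_(v D_i)(y) > t,
   and the interpolation a^s b^q <= a^tau + b^sigma makes
   sum_i diam(D_i)^s diam(v D_i)^q small.  As H^q need not be sigma-finite, one
   cannot integrate in y; instead one passes from this weighted cover of the bad
   points to a genuine one by a Vitali selection: disjoint subfamilies are peeled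
   off the weights until one of them is cheap enough, and its enlargement covers.
   This works for finite families, so the series is cut into blocks of sum
   O(4^-k), with thresholds t / 2^(k+1). *)
Require Import Defs.
From HB Require Import structures.
From mathcomp Require Import all_boot all_order all_algebra.
From mathcomp Require Import all_classical all_reals all_analysis.
From mathcomp Require Import ring lra.
Set Implicit Arguments. Unset Strict Implicit. Unset Printing Implicit Defensive.
Import Order.TTheory GRing.Theory Num.Theory.
Import numFieldNormedType.Exports.
Local Open Scope classical_set_scope.
Local Open Scope ring_scope.

(** * Vitali selection in finite weighted families *)

(** Indices are treated by decreasing [r], and each is kept unless it meets one kept before. The
    alternative [i = j] is there for an empty [A i], which meets nothing. *)
Lemma greedy_disjoint_subfamily (R : realDomainType) (T : Type) (I : eqType)
    (A : I -> set T) (r : I -> R) (s : seq I) :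
  exists J : seq I, [/\ uniq J, {subset J <= s},
    {in J &, forall i j, i != j -> A i `&` A j = set0} &
    forall i, i \in s -> exists2 j, j \in J &
      i = j \/ (r i <= r j /\ A i `&` A j !=set0)].
Proof.
pose le_r i j := r i <= r j.
(* With [r] increasing along the list, the induction settles the tail first and decides last on the
   head, whose [r] is smallest. *)
wlog : s / pairwise le_r s => [wlog_sorted|].
  have [|J [uJ Js disjJ covJ]] := wlog_sorted (sort le_r s).
    rewrite -sorted_pairwise; last by move=> a b c; exact: le_trans.
    by apply: sort_sorted => a b; exact: le_total.
  exists J; split=> // [i /Js|i is_]; first by rewrite mem_sort.
  by apply: covJ; rewrite mem_sort.
elim: s => [|x s IHs] /=; first by exists [::]; split.
move=> /andP[/allP xs /IHs[J [uJ Js disjJ covJ]]].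
have [[j jJ xj]|xJ] := pselect (exists2 j, j \in J & x = j \/ A x `&` A j !=set0).
  exists J; split=> // [i /Js|i]; first by rewrite inE orbC => ->.
  rewrite inE => /predU1P[->|/covJ //].
  exists j => //; case: xj => [|xj]; [by left | right; split=> //].
  exact/xs/Js.
have xJ0 j : j \in J -> A x `&` A j = set0.
  by move=> jJ; apply/eqP/negPn/negP => /set0P xj; apply: xJ; exists j => //; right.
exists (x :: J); split=> /=.
- by rewrite uJ andbT; apply/negP => ?; apply: xJ; exists x => //; left.
- by move=> i; rewrite !inE => /predU1P[->|/Js ->]; rewrite ?eqxx ?orbT.
- move=> i j; rewrite !inE => /predU1P[->|iJ] /predU1P[->|jJ].
  + by rewrite eqxx.
  + by move=> _; exact: xJ0.
  + by move=> _; rewrite setIC; exact: xJ0.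
  + exact: disjJ.
- move=> i; rewrite inE => /predU1P[->|/covJ[j jJ ij]].
    by exists x; [rewrite mem_head|left].
  by exists j => //; rewrite inE jJ orbT.
Qed.

(* Subtracting a multiple of the indicator of a disjoint subfamily lowers the
   total weight at each point by at most that multiple and can be made to kill a
   weight.  If every disjoint subfamily met in iterating this cost more than
   claimed, [\sum_i c i * w i] would be exhausted before the level [t] is. *)
Lemma weighted_cover (R : realType) (T : Type) (I : eqType) (A : I -> set T)
    (r w : I -> R) (s : seq I) (c : I -> R) (t : R) :
  uniq s -> (forall i, 0 <= w i) -> (forall i, 0 <= c i) -> 0 < t ->
  exists J : seq I, [/\ uniq J, {subset J <= s},
    t * \sum_(j <- J) w j <= \sum_(i <- s) c i * w i &
    forall y, t <= \sum_(i <- s) c i * \1_(A i) y -> exists i j, [/\ j \in J,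
      A i y & i = j \/ (r i <= r j /\ A i `&` A j !=set0)]].
Proof.
move=> us w0 c0 t0.
have [m] := ubnP (count (fun i => 0 < c i) s).
elim: m => // m IHm in c c0 t t0 *; rewrite ltnS => cm.
pose s' := [seq i <- s | 0 < c i].
have sumE (f : I -> R) : \sum_(i <- s) c i * f i = \sum_(i <- s') c i * f i.
  rewrite big_filter [LHS](bigID (fun i => 0 < c i)) /= [X in _ + X]big1 ?addr0//.
  by move=> i; rewrite -leNgt => ci; rewrite (@le_anti _ _ (c i) 0) ?mul0r// ci c0.
(* Selecting among positive weights only makes the minimum of [c] over [J] positive, so that
   subtracting it lowers the number of positive weights. *)
have [J [uJ Js disjJ covJ]] := @greedy_disjoint_subfamily R T I A r s'.
have inJ i : i \in J -> i \in s /\ 0 < c i.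
  by move=> /Js; rewrite mem_filter => /andP[].
have cov_J y : t <= \sum_(i <- s) c i * \1_(A i) y -> exists i j, [/\ j \in J,
      A i y & i = j \/ (r i <= r j /\ A i `&` A j !=set0)].
  rewrite sumE => ty; have [[i is' Aiy]|nA] := pselect (exists2 i, i \in s' & A i y).
    by have [j jJ ij] := covJ i is'; exists i, j.
  move: ty; rewrite big_seq big1 ?leNgt ?t0// => i is'.
  by rewrite indicE memNset ?mulr0// => Aiy; apply: nA; exists i.
have [J0|/negPn/hasP[x xJ _]] := boolP (~~ has predT J).
  exists J; split=> // [i /inJ[] //|].
  have -> : J = [::] by case: (J) J0.
  by rewrite big_nil mulr0 sumr_ge0// => i _; rewrite mulr_ge0.
have [x1 x1J x1min] : exists2 x, x \in J & forall j, j \in J -> c x <= c j.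
  clear -xJ; elim: J x xJ => // a J IH x _.
  case: J => [|b J] in IH *.
    by exists a; rewrite ?mem_head// => j; rewrite inE => /eqP ->.
  have [z zJ zmin] := IH b (mem_head _ _).
  have [az|za] := leP (c a) (c z).
    exists a; rewrite ?mem_head// => j; rewrite inE => /predU1P[->//|/zmin].
    exact: le_trans.
  exists z; first by rewrite inE zJ orbT.
  by move=> j; rewrite inE => /predU1P[->|/zmin//]; exact: ltW.
have cx1 : 0 < c x1 by have [] := inJ _ x1J.
have sumJ (f : I -> R) : \sum_(i <- s) (i \in J)%:R * f i = \sum_(j <- J) f j.
  under eq_bigr do rewrite mulr_natl mulrb.
  rewrite -big_mkcond -big_filter; apply: perm_big; apply: uniq_perm => //.
    exact: filter_uniq.
  by move=> i; rewrite mem_filter andb_idr// => /inJ[].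
pose c' i := c i - c x1 * (i \in J)%:R.
have c'0 i : 0 <= c' i.
  rewrite /c'; case: (boolP (i \in J)) => [iJ|_]; last by rewrite mulr0 subr0.
  by rewrite mulr1 subr_ge0 x1min.
have sum_c' (f : I -> R) :
    \sum_(i <- s) c' i * f i = \sum_(i <- s) c i * f i - c x1 * \sum_(j <- J) f j.
  rewrite -sumJ mulr_sumr -sumrB; apply: eq_bigr => i _.
  by rewrite mulrBl mulrA.
have [tJ|tJ] := leP (t * \sum_(j <- J) w j) (\sum_(i <- s) c i * w i).
  by exists J; split=> // i /inJ[].
have wJ : 0 < \sum_(j <- J) w j.
  rewrite -(pmulr_rgt0 _ t0); apply: le_lt_trans tJ.
  by rewrite sumr_ge0// => i _; rewrite mulr_ge0.
have cJ : c x1 * \sum_(j <- J) w j <= \sum_(i <- s) c i * w i.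
  by rewrite -subr_ge0 -sum_c' sumr_ge0// => i _; rewrite mulr_ge0.
(* As [J] costs more than claimed, [c x1] is below [t]: the lowered level [t - c x1] is still
   positive. *)
have ct : c x1 < t by rewrite -(ltr_pM2r wJ); exact: le_lt_trans cJ tJ.
have t'0 : 0 < t - c x1 by rewrite subr_gt0.
have count_lt : (count (fun i => (0 < c' i)%R) s < m)%N.
  apply: leq_trans cm; have [x1s _] := inJ _ x1J.
  have /permP cp := perm_to_rem x1s.
  rewrite !cp /= cx1 /c' x1J mulr1 subrr ltxx add0n add1n ltnS.
  apply: sub_count => i /= /lt_le_trans; apply.
  by rewrite gerBl mulr_ge0// ltW.
have [J' [uJ' J's J'w J'cov]] := IHm c' c'0 _ t'0 count_lt.
exists J'; split=> // [|y ty].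
  move: J'w; rewrite sum_c' => J'w.
  (* The weighted total has lost [c x1] times the cost of [J]. Since [J] is too expensive, [J']
     comes out cheaper than [J], and adding back [c x1] times its cost restores the bound at level
     [t]. *)
  have : (t - c x1) * \sum_(j <- J') w j < (t - c x1) * \sum_(j <- J) w j.
    by apply: le_lt_trans J'w _; rewrite mulrBl ltrD2r.
  rewrite ltr_pM2l// => J'J.
  have := ler_wpM2l (ltW cx1) (ltW J'J); lra.
(* By disjointness a point lies in at most one [A j] with [j] in [J], so its total weight drops by
   at most [c x1]. *)
apply: J'cov; rewrite sum_c' lerB//.
rewrite -[leRHS]mulr1; apply: ler_wpM2l (ltW cx1) _ _ _.
have [[j jJ Ajy]|nA] := pselect (exists2 j, j \in J & A j y).
  rewrite (bigD1_seq j) //= indicE mem_set// big_seq_cond big1 ?addr0 ?lexx//.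
  move=> i /andP[iJ ij]; rewrite indicE memNset// => Aiy.
  by have := disjJ _ _ iJ jJ ij => /seteqP[/(_ y)] /(_ (conj Aiy Ajy)).
rewrite big_seq big1 ?ler01// => j jJ; rewrite indicE memNset// => Ajy.
by apply: nA; exists j.
Qed.

(** * Euclidean distance against the maximum norm *)

(** Diameters are Euclidean, while the norm of row vectors is the maximum norm. Comparing the two
    gives access to the triangle inequality of the norm, at the price of a dimensional constant. *)
Lemma normm_le_edist (R : realType) (m : nat) (x y : 'rV[R]_m) :
  `|x - y| <= Defs.edist x y.
Proof.
rewrite /Num.norm/= mx_normrE; apply/bigmax_leP; split; first exact: sqrtr_ge0.
move=> [i j] _ /=; rewrite !mxE ord1 -sqrtr_sqr ler_sqrt; last first.
  by rewrite sumr_ge0// => k _; exact: sqr_ge0.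
by rewrite (bigD1 j)//= lerDl sumr_ge0// => k _; exact: sqr_ge0.
Qed.

Lemma edist_le_normm (R : realType) (m : nat) (x y : 'rV[R]_m) :
  Defs.edist x y <= m%:R * `|x - y|.
Proof.
have mN0 : 0 <= m%:R * `|x - y| by rewrite mulr_ge0.
rewrite -(ger0_norm mN0) -sqrtr_sqr ler_sqrt ?sqr_ge0// exprMn.
apply: (@le_trans _ _ (\sum_(i < m) `|x - y| ^+ 2)).
  apply: ler_sum => i _; rewrite -[leLHS]real_normK ?num_real//.
  rewrite ler_pXn2r ?nnegrE//.
  rewrite [leRHS]/Num.norm/= mx_normrE.
  by apply: (bigmax_sup (ord0, i)); rewrite //= !mxE.
rewrite sumr_const card_ord -[leLHS]mulr_natl ler_wpM2r ?sqr_ge0//.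
by rewrite -natrX ler_nat; case: (m) => // k; rewrite expnS leq_pmulr// expn_gt0.
Qed.

(** * Hausdorff null sets and covers of small cost *)

Section coverings.
Context {R : realType} {m : nat}.
Implicit Types (A E : set 'rV[R]_m) (s q e M : R).

Definition cost s A : R := fine (hterm s A).

(* Finiteness of the diameters matters: [fine +oo = 0], so an unbounded set would
   be free in [cost].  No mesh bound is imposed: a small total cost forces small
   diameters as soon as [0 < s]. *)
Definition covered s E e := exists C : nat -> set 'rV[R]_m,
  [/\ E `<=` \bigcup_i C i, forall i, (ediam (C i) < +oo)%E &
      forall n, \sum_(0 <= i < n) cost s (C i) <= e].

Lemma hterm_cost s A : hterm s A = (cost s A)%:E.
Proof. by rewrite /cost /hterm; case: ifP. Qed.

Lemma cost_ge0 s A : 0 <= cost s A.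
Proof. by rewrite /cost /hterm; case: ifP => //= _; exact: powR_ge0. Qed.

Lemma hterm_ge0 s A : (0 <= hterm s A)%E.
Proof. by rewrite hterm_cost lee_fin cost_ge0. Qed.

Lemma cost_set0 s : cost s set0 = 0.
Proof. by rewrite /cost /hterm eqxx. Qed.

Lemma cost_neq0 s A : A !=set0 -> cost s A = fine (ediam A) `^ s.
Proof. by rewrite /cost /hterm => /set0P/negbTE ->. Qed.

Lemma ediam0 : ediam (@set0 'rV[R]_m) = -oo%E.
Proof.
rewrite /ediam (_ : [set _ | _ in _ & _ in _] = set0) ?ereal_sup0//.
by rewrite -subset0 => z [x []].
Qed.

Lemma ediam_ge0 A : A !=set0 -> (0 <= ediam A)%E.
Proof.
move=> [x Ax]; apply: (@le_trans _ _ (Defs.edist x x)%:E).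
  by rewrite lee_fin sqrtr_ge0.
by apply: ereal_sup_ubound; exists x => //; exists x.
Qed.

Lemma diam_ge0 A : 0 <= fine (ediam A).
Proof.
have [->|/set0P/ediam_ge0/fine_ge0//] := eqVneq A set0.
by rewrite ediam0.
Qed.

Lemma ediam_fineK A : A !=set0 -> (ediam A < +oo)%E ->
  (fine (ediam A))%:E = ediam A.
Proof. by move=> A0 Aoo; rewrite fineK// ge0_fin_numE// ediam_ge0. Qed.

Lemma edist_le_diam A x y : (ediam A < +oo)%E -> A x -> A y ->
  Defs.edist x y <= fine (ediam A).
Proof.
move=> Aoo Ax Ay; rewrite -lee_fin ediam_fineK//; last by exists x.
by apply: ereal_sup_ubound; exists x => //; exists y.
Qed.

Lemma ediam_le A M : (forall x y, A x -> A y -> Defs.edist x y <= M) ->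
  (ediam A <= M%:E)%E.
Proof.
by move=> AM; apply: ge_ereal_sup => _ [x Ax [y Ay <-]]; rewrite lee_fin AM.
Qed.

Lemma cost_le s A M : 0 <= s -> (ediam A <= M%:E)%E -> cost s A <= M `^ s.
Proof.
move=> s0 AM; have [->|/set0P A0] := eqVneq A set0.
  by rewrite cost_set0 powR_ge0.
have := AM; rewrite -ediam_fineK//; last exact: le_lt_trans AM (ltry _).
rewrite lee_fin cost_neq0// => dM.
by rewrite ge0_ler_powR ?nnegrE ?diam_ge0//; apply: le_trans dM; exact: diam_ge0.
Qed.

Lemma compact_ediam_lty A : compact A -> (ediam A < +oo)%E.
Proof.
move=> /compact_bounded[M0 [_ /(_ (M0 + 1))]].
rewrite ltrDl ltr01 => /(_ isT); set M := M0 + 1 => AM.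
apply: (@le_lt_trans _ _ (m%:R * (M + M))%:E); last exact: ltry.
apply: ediam_le => x y Ax Ay; apply: le_trans (edist_le_normm _ _) _.
rewrite ler_wpM2l//; apply: le_trans (ler_normB _ _) _.
by rewrite lerD//; exact: AM.
Qed.

Lemma covered_subset s E E' e : E `<=` E' -> covered s E' e -> covered s E e.
Proof.
by move=> EE' [C [E'C Coo Ce]]; exists C; split=> //; exact: subset_trans E'C.
Qed.

Lemma covered_le s E e e' : e <= e' -> covered s E e -> covered s E e'.
Proof.
by move=> ee' [C [EC Coo Ce]]; exists C; split=> // n; exact: le_trans ee'.
Qed.

Lemma sum_cost_le s (C : nat -> set 'rV[R]_m) e :
  (\sum_(0 <= i <oo) hterm s (C i) < e%:E)%E ->
  forall n, \sum_(0 <= i < n) cost s (C i) <= e.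
Proof.
move=> Ce n; rewrite -lee_fin; apply: le_trans (ltW Ce).
rewrite -sumEFin; under eq_bigr do rewrite -hterm_cost.
by apply: nneseries_lim_ge => k _ _; exact: hterm_ge0.
Qed.

Lemma nneseries_hterm_le s (C : nat -> set 'rV[R]_m) e :
  (forall n, \sum_(0 <= i < n) cost s (C i) <= e) ->
  (\sum_(0 <= i <oo) hterm s (C i) <= e%:E)%E.
Proof.
move=> Ce; apply: lime_le.
  by apply: is_cvg_nneseries => k _ _; exact: hterm_ge0.
apply: nearW => n; under eq_bigr do rewrite hterm_cost.
by rewrite sumEFin lee_fin.
Qed.

Lemma hausdorff_ge0 s E : (0 <= hausdorff s E)%E.
Proof.
apply: (@le_trans _ _ (hcontent s 1 E)); last first.
  by apply: ereal_sup_ubound; exists 1 => //=.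
apply/ereal_infP => _ [C _ <-].
by apply: nneseries_ge0 => n _ _; exact: hterm_ge0.
Qed.

Lemma hausdorff_subset s E E' : E `<=` E' -> (hausdorff s E <= hausdorff s E')%E.
Proof.
move=> EE'; apply: ge_ereal_sup => _ [delta delta0 <-].
apply: (@le_trans _ _ (hcontent s delta E')); last first.
  by apply: ereal_sup_ubound; exists delta.
apply: ereal_inf_le_tmp => _ [C [E'C Cd] <-].
by exists C => //; split=> //; exact: subset_trans E'C.
Qed.

Lemma hausdorff_set0 s : hausdorff s (@set0 'rV[R]_m) = 0%E.
Proof.
apply/eqP; rewrite eq_le hausdorff_ge0 andbT.
apply: ge_ereal_sup => _ [delta delta0 <-]; apply: ereal_inf_lbound.
exists (fun=> set0); first by split=> // i; rewrite ediam0 leNye.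
by apply: eseries0 => i _ _; rewrite hterm_cost cost_set0.
Qed.

Lemma hausdorff_eq0P s E : 0 < s ->
  hausdorff s E = 0%E <-> (forall e, 0 < e -> covered s E e).
Proof.
move=> s0; split=> [E0 e e0|covE].
  have : (hcontent s 1 E < e%:E)%E.
    apply: (@le_lt_trans _ _ 0%E); rewrite ?lte_fin// -E0.
    by apply: ereal_sup_ubound; exists 1 => //=.
  move=> /ereal_inf_lt[_ [C [EC C1] <-] Ce].
  exists C; split=> // [i|]; first exact: le_lt_trans (C1 i) (ltry _).
  exact: sum_cost_le.
apply/eqP; rewrite eq_le hausdorff_ge0 andbT.
apply: ge_ereal_sup => _ [delta /= delta0 <-].
apply/lee_addgt0Pr => e e0; rewrite add0e.
(* A total cost of at most the [s]-th power of [delta] bounds every single term, hence every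
   diameter by [delta], because [0 < s]. *)
have e'0 : 0 < Num.min e (delta `^ s) by rewrite lt_min e0 powR_gt0.
have [C [EC Coo Ce]] := covE _ e'0.
apply: ge_ereal_inf; exists (\sum_(0 <= i <oo) hterm s (C i))%E; last first.
  by apply: nneseries_hterm_le => n; apply: le_trans (Ce n) _; rewrite ge_min lexx.
exists C => //; split=> // i.
have [->|/set0P Ci0] := eqVneq (C i) set0; first by rewrite ediam0 leNye.
have : cost s (C i) <= delta `^ s.
  apply: le_trans (le_trans (Ce i.+1) _); last by rewrite ge_min lexx orbT.
  by rewrite big_nat_recr//= lerDr sumr_ge0// => k _; exact: cost_ge0.
rewrite cost_neq0// -ediam_fineK// lee_fin leNgt => dsC; rewrite leNgt.
apply: contra dsC; apply: gt0_ltr_powR => //; rewrite nnegrE ?diam_ge0//.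
exact: ltW.
Qed.

Lemma sum_nth_le (T : Type) (f : T -> R) (x0 : T) (l : seq T) n :
  (forall x, 0 <= f x) -> f x0 = 0 ->
  \sum_(0 <= i < n) f (nth x0 l i) <= \sum_(x <- l) f x.
Proof.
move=> f0 fx0; elim: l n => [|x l IHl] n.
  by rewrite big_nil big1// => i _; rewrite nth_nil.
case: n => [|n]; first by rewrite big_geq// sumr_ge0.
by rewrite big_nat_recl// big_cons lerD2l.
Qed.

Lemma covered_seq (I : eqType) s E e (J : seq I) (U : I -> set 'rV[R]_m) :
  (forall y, E y -> exists2 j, j \in J & U j y) ->
  (forall j, j \in J -> (ediam (U j) < +oo)%E) ->
  \sum_(j <- J) cost s (U j) <= e -> covered s E e.
Proof.
move=> EU Uoo Ue; exists (nth set0 (map U J)); split.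
- move=> y /EU[j jJ Ujy]; exists (index j J) => //.
  by rewrite (nth_map j) ?index_mem// nth_index.
- move=> i; have [iJ|Ji] := ltnP i (size (map U J)); last first.
    by rewrite nth_default// ediam0.
  by have /mapP[j jJ ->] := mem_nth set0 iJ; exact: Uoo.
- move=> n; apply: le_trans Ue; rewrite -(big_map U predT (cost s)).
  by apply: sum_nth_le => [A|]; [exact: cost_ge0|exact: cost_set0].
Qed.

Lemma sum_half_pow_le e n : 0 <= e ->
  \sum_(0 <= k < n) e / 2 ^+ k.+1 <= e.
Proof.
move=> e0; have -> : \sum_(0 <= k < n) e / 2 ^+ k.+1 = e - e / 2 ^+ n.
  elim: n => [|n IHn]; first by rewrite big_geq// expr0 divr1 subrr.
  by rewrite big_nat_recr//= IHn exprS; field; rewrite expf_neq0.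
by rewrite gerBl divr_ge0// exprn_ge0.
Qed.

Lemma covered_bigcup s (F : nat -> set 'rV[R]_m) e : 0 <= e ->
  (forall k, covered s (F k) (e / 2 ^+ k.+1)) -> covered s (\bigcup_k F k) e.
Proof.
move=> e0 /choice[C CP].
(* All [C k l] are enumerated through codes of pairs; an integer coding no pair gives the empty set,
   at cost 0. *)
pose D i := oapp (fun p : nat * nat => C p.1 p.2) set0 (pickle_inv i).
exists D; split.
- move=> y [k _ Fky]; have [/(_ y Fky)[l _ Ckl] _ _] := CP k.
  by exists (pickle (k, l)) => //; rewrite /D pickleK_inv.
- move=> i; rewrite /D; case: (pickle_inv i) => [[k l]|] /=; last by rewrite ediam0.
  by have [_ + _] := CP k; apply.
move=> n; pose P := pmap (@pickle_inv (nat * nat)%type) (index_iota 0 n).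
have -> : \sum_(0 <= i < n) cost s (D i) = \sum_(p <- P) cost s (C p.1 p.2).
  rewrite big_pmap; apply: eq_bigr => i _; rewrite /D.
  by case: (pickle_inv i) => //=; exact: cost_set0.
(* The finitely many pairs in a partial sum lie in a [K] by [L] rectangle, which is summed row by
   row. *)
pose K := (\max_(p <- P) p.1).+1; pose L := (\max_(p <- P) p.2).+1.
apply: (@le_trans _ _ (\sum_(0 <= k < K) \sum_(0 <= l < L) cost s (C k l))).
  pose Q := [seq (k, l) | k <- index_iota 0 K, l <- index_iota 0 L].
  rewrite -(@big_allpairs _ _ _ _ _ _ _ (fun p => cost s (C p.1 p.2)))/= -/Q.
  have uP : uniq P by apply: pmap_uniq (iota_uniq _ _); exact: pickle_invK.
  have uQ : uniq Q.
    by apply: allpairs_uniq; rewrite ?iota_uniq// => -[? ?] [? ?].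
  rewrite [leRHS](bigID (mem P))/= -[leLHS]addr0 lerD//; last first.
    by rewrite sumr_ge0// => p _; exact: cost_ge0.
  rewrite -[leRHS]big_filter le_eqVlt; apply/orP; left; apply/eqP.
  apply: perm_big; apply: uniq_perm => //; first exact: filter_uniq.
  move=> p; have QP : p \in P -> p \in Q; last by rewrite mem_filter andb_idr.
  case: p => k l pP; apply/allpairsP; exists (k, l).
  rewrite !mem_index_iota !ltnS; split=> //.
    exact: (leq_bigmax_seq (k, l)).
  exact: (leq_bigmax_seq (F := snd) (k, l)).
apply: le_trans (sum_half_pow_le K e0).
by apply: ler_sum => k _; have [_ _] := CP k; apply.
Qed.
End coverings.

(** * Level sets of weighted covers *)

(** For positive [k], block [k] starts where all later sums are below [delta / 4 ^+ k]; block 0 uses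
    only the bound on the whole series. *)
Lemma summable_blocks (R : realType) (x : nat -> R) (delta : R) :
  (forall i, 0 <= x i) -> (forall n, \sum_(0 <= i < n) x i <= delta) ->
  0 < delta ->
  exists M : nat -> nat, [/\ M 0%N = 0%N, forall k, (M k < M k.+1)%N &
    forall k, \sum_(M k <= i < M k.+1) x i <= delta / 4 ^+ k].
Proof.
move=> x0 xd d0.
pose S := [set \sum_(0 <= i < n) x i | n in [set: nat]].
have supS : has_sup S.
  by split; [exists (\sum_(0 <= i < 0) x i), 0%N|exists delta => _ [n _ <-]].
have small k : exists N, forall a b, (N <= a)%N ->
    \sum_(a <= i < b) x i <= delta / 4 ^+ k.
  have [_ [N _ <-] SN] := sup_adherent (divr_gt0 d0 (exprn_gt0 k (ltr0n R 4))) supS.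
  exists N => a b Na; have [ab|/ltnW ba] := leqP a b; last first.
    by rewrite big_geq// divr_ge0 ?ltW ?exprn_gt0.
  have : \sum_(0 <= i < b) x i <= sup S by apply: ub_le_sup; [case: supS|exists b].
  rewrite (big_cat_nat (leq0n N) (leq_trans Na ab))/= (big_cat_nat Na ab)/=.
  have : 0 <= \sum_(N <= i < a) x i by rewrite sumr_ge0.
  lra.
have [N NP] := choice small.
pose fix M k := if k is k'.+1 then (M k' + N k).+1 else 0%N.
exists M; split=> // [k|k]; first by rewrite /= ltnS leq_addr.
case: k => [|k]; first by rewrite expr0 divr1.
by apply: NP; rewrite leqW// leq_addl.
Qed.

(** A Chebyshev inequality without integration. The factor [3 * m%:R] comes from enlarging the
    selected sets, the factor 4 from the cut into blocks. *)
Lemma level_set_covered (R : realType) (m : nat) (q delta t : R)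
    (A : nat -> set 'rV[R]_m) (c : nat -> R) :
  0 < q -> 0 < delta -> 0 < t ->
  (forall i, (ediam (A i) < +oo)%E) -> (forall i, 0 <= c i) ->
  (forall n, \sum_(0 <= i < n) c i * fine (ediam (A i)) `^ q <= delta) ->
  covered q [set y | exists n, t < \sum_(0 <= i < n) c i * \1_(A i) y]
    (4 * (3 * m%:R) `^ q * delta / t).
Proof.
move=> q0 d0 t0 Aoo c0 cd.
pose w i := fine (ediam (A i)) `^ q; pose K : R := (3 * m%:R) `^ q.
have K0 : 0 <= K by exact: powR_ge0.
have [M [M0 Mlt Md]] : exists M : nat -> nat, [/\ M 0%N = 0%N,
    forall k, (M k < M k.+1)%N &
    forall k, \sum_(M k <= i < M k.+1) c i * w i <= delta / 4 ^+ k].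
  by apply: summable_blocks => // i; rewrite mulr_ge0 ?powR_ge0.
(* A point avoiding all [F k] has weight at most [\sum_k t / 2 ^ k.+1 = t], and
   each [F k] only involves finitely many sets. *)
pose F k := [set y | t / 2 ^+ k.+1 <= \sum_(M k <= i < M k.+1) c i * \1_(A i) y].
apply: (@covered_subset _ _ _ _ (\bigcup_k F k)).
  move=> y [n tn]; apply: contrapT => Fy; move: tn; apply/negP; rewrite -leNgt.
  have nM : (n <= M n)%N by elim: (n) => // k /leq_ltn_trans; apply.
  have c1 i : 0 <= c i * \1_(A i) y by rewrite mulr_ge0.
  apply: (@le_trans _ _ (\sum_(0 <= i < M n) c i * \1_(A i) y)).
    by rewrite [leRHS](big_cat_nat (leq0n n) nM)/= lerDl sumr_ge0.
  apply: le_trans (sum_half_pow_le n (ltW t0)).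
  elim: (n) => [|k IHk]; first by rewrite M0 !big_geq.
  rewrite big_nat_recr//= (big_cat_nat (leq0n _) (ltnW (Mlt k)))/= lerD//.
  by apply/ltW; rewrite ltNge; apply/negP => tk; apply: Fy; exists k.
apply: covered_bigcup => [|k].
  by rewrite divr_ge0 ?(ltW t0)// mulr_ge0 ?(ltW d0)// mulr_ge0.
pose r i := fine (ediam (A i)).
have tk0 : 0 < t / 2 ^+ k.+1 by rewrite divr_gt0// exprn_gt0.
have [J [uJ Js wJ covJ]] := @weighted_cover R _ _ A r w (index_iota (M k) (M k.+1))
  c _ (iota_uniq _ _) (fun i => powR_ge0 _ _) c0 tk0.
(* [U j] gathers [A j] and the sets no larger that meet it. It stays within [r j] of [A j] in the
   maximum norm, so its diameter there is at most [3 * r j]. *)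
pose U j := [set y | exists i, A i y /\ (i = j \/ (r i <= r j /\ A i `&` A j !=set0))].
have UJ j y : U j y -> exists2 z, A j z & `|y - z| <= r j.
  move=> [i [Aiy [ij|[rij [z [Aiz Ajz]]]]]].
    by exists y; rewrite -?ij// subrr normr0 diam_ge0.
  exists z => //; apply: le_trans rij; apply: le_trans (normm_le_edist _ _) _.
  exact: edist_le_diam.
have Udiam j : (ediam (U j) <= (3 * m%:R * r j)%:E)%E.
  apply: ediam_le => x y /UJ[x' Ax' xx'] /UJ[y' Ay' yy'].
  apply: le_trans (edist_le_normm _ _) _.
  rewrite -mulrA mulrCA ler_wpM2l//.
  have xy' : `|x' - y'| <= r j.
    by apply: le_trans (normm_le_edist _ _) _; exact: edist_le_diam.
  have -> : x - y = (x - x') + (x' - y') - (y - y') by rewrite opprB !addrA !subrK.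
  apply: le_trans (ler_normB _ _) _; apply: le_trans (lerD (ler_normD _ _) (lexx _)) _.
  lra.
apply: (@covered_seq _ _ _ _ _ _ J U).
- by move=> y /covJ[i [j [jJ Aiy ij]]]; exists j => //; exists i.
- by move=> j _; apply: le_lt_trans (Udiam j) _; exact: ltry.
apply: (@le_trans _ _ (K * \sum_(j <- J) w j)).
  rewrite mulr_sumr; apply: ler_sum => j _.
  apply: le_trans (cost_le (ltW q0) (Udiam j)) _.
  by rewrite powRM// ?mulr_ge0// diam_ge0.
have {}wJ := le_trans wJ (Md k).
have p2 : 0 < (2 : R) ^+ k by exact: exprn_gt0.
(* Mass [delta / 4 ^+ k] over threshold [t / 2 ^+ k.+1] leaves [4 * delta / t] divided by
   [2 ^+ k.+1], the share of block [k]. *)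
have -> : 4 * K * delta / t / 2 ^+ k.+1 = K * ((delta / 4 ^+ k) / (t / 2 ^+ k.+1)).
  rewrite (_ : 4 = 2 * 2 :> R); last by rewrite -natrM.
  rewrite exprMn exprS; field; rewrite ?expf_neq0//.
  by rewrite (gt_eqF t0) ?(gt_eqF p2).
by apply: ler_wpM2l => //; rewrite ler_pdivlMr// mulrC.
Qed.

(** The left side is a weighted geometric mean of the two terms on the right, with exponents
    [1 - q / sigma] and [q / sigma]; each term is at most their sum. *)
Lemma powR_interpolation (R : realType) (a b tau sigma q : R) :
  0 < sigma -> 0 <= q <= sigma ->
  a `^ (tau * (1 - q / sigma)) * b `^ q <= a `^ tau + b `^ sigma.
Proof.
move=> s0 /andP[q0 qs].
have th0 : 0 <= q / sigma by rewrite divr_ge0 ?(ltW s0).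
have th1 : 0 <= 1 - q / sigma by rewrite subr_ge0 ler_pdivrMr// mul1r.
have -> : b `^ q = (b `^ sigma) `^ (q / sigma).
  by rewrite -powRrM mulrC divfK// gt_eqF.
rewrite powRrM.
set X := _ `^ tau; set Y := _ `^ sigma.
have X0 : 0 <= X by exact: powR_ge0.
have Y0 : 0 <= Y by exact: powR_ge0.
have XY0 : 0 <= X + Y by exact: addr_ge0.
have -> : X + Y = (X + Y) `^ (1 - q / sigma) * (X + Y) `^ (q / sigma).
  by rewrite -powRD subrK ?powRr1// oner_eq0.
by apply: ler_pM; rewrite ?powR_ge0// ge0_ler_powR ?nnegrE ?lerDl ?lerDr.
Qed.
Theorem theorem4p1 (R : realType) (n d : nat) (tau sigma : R)
  (v : 'rV[R]_n -> 'rV[R]_d)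
  (htau : 0 < tau <= n%:R) (hsigma : 0 < sigma) (hv : continuous v)
  (hyp : forall E : set 'rV[R]_n, hausdorff tau E = 0%E ->
     forall eps : R, 0 < eps ->
     exists D : nat -> set 'rV[R]_n,
       (forall i, compact (D i)) /\ E `<=` \bigcup_i D i /\
       (\sum_(0 <= i <oo) hterm tau (D i) < eps%:E)%E /\
       (\sum_(0 <= i <oo) hterm sigma (v @` D i) < eps%:E)%E) :
  N_star_property tau sigma v.
Proof.
move=> q /andP[q0 qs] E E0.
have tau0 : 0 < tau by case/andP: htau.
have vDoo (D : set 'rV[R]_n) : compact D -> (ediam (v @` D) < +oo)%E.
  move=> cD; apply: compact_ediam_lty; apply: continuous_compact => //.
  exact: continuous_subspaceT.
(* For [q = 0] the exponent is [tau], and every fibre is null as a subset of [E]. *)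
move: q0; rewrite le_eqVlt => /predU1P[<-|q0].
  exists set0; split=> [|y _]; first exact: hausdorff_set0.
  rewrite mul0r subr0 mulr1; apply/eqP; rewrite eq_le hausdorff_ge0 andbT -E0.
  by apply: hausdorff_subset; exact: subIsetl.
(* For [q = sigma] the exponent is 0, so fibres have to be empty: the exceptional set is the image
   of [E], null by the second sum of the hypothesis. *)
move: (qs); rewrite le_eqVlt => /predU1P[qE|q_lt].
  exists (v @` E); split=> [|y vEy].
    apply/hausdorff_eq0P => // e e0; rewrite qE.
    have [D [cD [ED [_ De]]]] := hyp E E0 e e0.
    exists (fun i => v @` D i); split=> [|i|]; [|exact: vDoo|exact: sum_cost_le].
    by move=> _ [x /ED[i _ Dix] <-]; exists i => //; exists x.
  rewrite (_ : _ `&` _ = set0) ?hausdorff_set0// -subset0 => x [Ex vx].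
  by apply: vEy; exists x.
have s0 : 0 < tau * (1 - q / sigma).
  by rewrite mulr_gt0// subr_gt0 ltr_pdivrMr// mul1r.
move: s0; set s := tau * _ => s0.
exists [set y | hausdorff s (E `&` v @^-1` [set y]) <> 0%E]; split; last first.
  by move=> y /contrapT.
apply/hausdorff_eq0P => // e e0.
(* The bad points are split by a quantitative failure of nullity, cost [k.+1%:R^-1], so that each
   piece is handled at a fixed threshold. *)
pose F k := [set y | ~ covered s (E `&` v @^-1` [set y]) k.+1%:R^-1].
apply: (@covered_subset _ _ _ _ (\bigcup_k F k)).
  move=> y /=; apply: contra_notP => Fy; apply/hausdorff_eq0P => // eta eta0.
  have [k keta] := ltr_add_invr eta0; rewrite add0r in keta.
  apply: covered_le (ltW keta) _; apply: contrapT => nk.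
  by apply: Fy; exists k.
apply: covered_bigcup (ltW e0) _ => k.
pose t : R := k.+1%:R^-1; have t0 : 0 < t by rewrite invr_gt0.
pose K : R := (3 * d%:R) `^ q; have K0 : 0 <= K by exact: powR_ge0.
pose ek := e / 2 ^+ k.+1; have ek0 : 0 < ek by rewrite divr_gt0 ?exprn_gt0.
(* Chosen so that the level set bound [4 * K * delta / t] is at most [ek]. The [+ 1] guards against
   [K = 0], which occurs for [d = 0]. *)
pose delta := t * ek / (4 * (K + 1)).
have d0 : 0 < delta by rewrite divr_gt0 ?mulr_gt0 ?ltr_wpDl.
(* Half of [delta] for each of the two sums that the interpolation adds. *)
have [D [cD [ED [tauD sigmaD]]]] := hyp E E0 _ (divr_gt0 d0 (ltr0n R 2)).
have Ke : 4 * K * delta / t <= ek.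
  have -> : 4 * K * delta / t = K / (K + 1) * ek.
    by rewrite /delta; field; rewrite (gt_eqF t0) gt_eqF ?ltr_wpDl.
  by rewrite ler_piMl ?(ltW ek0)// ler_pdivrMr ?mul1r ?lerDl ?ltr_wpDl.
apply: (covered_le Ke).
have cw m : \sum_(0 <= i < m) cost s (D i) * fine (ediam (v @` D i)) `^ q <= delta.
  rewrite [delta]splitr.
  apply: le_trans (lerD (sum_cost_le tauD m) (sum_cost_le sigmaD m)).
  rewrite -big_split/=; apply: ler_sum => i _.
  have [->|/set0P Di] := eqVneq (D i) set0.
    by rewrite cost_set0 mul0r addr_ge0 ?cost_ge0.
  have vDi : v @` D i !=set0 by have [x Dx] := Di; exists (v x), x.
  rewrite !cost_neq0//; apply: powR_interpolation => //.
  by rewrite ltW.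
apply: covered_subset (level_set_covered q0 d0 t0 (fun i => vDoo _ (cD i))
  (fun i => cost_ge0 s (D i)) cw).
move=> y nk /=; apply: contrapT => small; apply: nk.
(* Only the [D i] whose image contains [y] can meet the fibre. Emptying the others turns the cost of
   this cover into the weighted sum at [y]. *)
exists (fun i => if y \in v @` D i then D i else set0); split.
- move=> x [Ex vx]; have [i _ Dx] := ED _ Ex; exists i => //.
  by rewrite mem_set//; exists x.
- move=> i; case: ifP => _; last by rewrite ediam0.
  exact: compact_ediam_lty.
- move=> m; rewrite leNgt; apply/negP => tm; apply: small; exists m.
  apply: lt_le_trans tm _; apply: ler_sum => i _; rewrite indicE.
  by case: ifP => _; rewrite ?cost_set0 ?mulr1 ?mulr0.
Qed.
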